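(* For every Hilbert space $\mathcal H$ the following hold. (i) $\mathbf D_{\mathbf q}(\mathcal H)$ is relatively open in $B(\mathcal H)^{n_1}\times_c\cdots\times_c B(\mathcal H)^{n_k}$, and its closure $\mathbf D_{\mathbf q}(\mathcal H)^-$ in the operator norm topology coincides with $\mathbf D^-_{\mathbf q}(\mathcal H)$. (ii) $\mathbf D_{\mathbf q}(\mathcal H)$ is a complete Reinhardt domain such that $$\mathbf D_{\mathbf q}(\mathcal H)=\bigcup_{\mathbf z\in\overline{\mathbb D}^{n_1+\cdots+n_k}}\mathbf z\mathbf D_{\mathbf q}(\mathcal H)=\bigcup_{\mathbf z\in\mathbb D^{n_1+\cdots+n_k}}\mathbf z\mathbf D_{\mathbf q}(\mathcal H)^-=\bigcup_{\mathbf z\in\mathbb D^{n_1+\cdots+n_k}}\mathbf z\mathbf D_{\mathbf q}(\mathcal H)$$ and $$\mathbf D_{\mathbf q}(\mathcal H)=\bigcup_{0\le r<1}r\mathbf D_{\mathbf q}(\mathcal H)=\bigcup_{0\le r<1}r\mathbf D_{\mathbf q}(\mathcal H)^-.$$ (iii) $\mathbf D_{\mathbf q}(\mathcal H)^-$ is a complete Reinhardt set and $$\mathbf D_{\mathbf q}(\mathcal H)^-=\bigcup_{\mathbf z\in\overline{\mathbb D}^{n_1+\cdots+n_k}}\mathbf z\mathbf D_{\mathbf q}(\mathcal H)^-=\bigcup_{0\le r\le1}r\mathbf D_{\mathbf q}(\mathcal H)^-.$$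
   Context: Polydomains. Fix $k\in\mathbb N=\{1,2,\dots\}$ and $n_1,\dots,n_k\in\mathbb N$. Hilbert spaces are complex; $B(\mathcal H)$ is the algebra of all bounded linear operators on $\mathcal H$; $A>0$ means that the operator $A$ is positive and invertible. $\mathbb F_{n_i}^+$ is the unital free semigroup on generators $g^i_1,\dots,g^i_{n_i}$ with identity $g^i_0$. For $X_i=(X_{i,1},\dots,X_{i,n_i})\in B(\mathcal H)^{n_i}$ put $X_{i,\alpha}:=X_{i,j_1}\cdots X_{i,j_p}$ if $\alpha=g^i_{j_1}\cdots g^i_{j_p}$, and $X_{i,g_0^i}:=I$. Fix $\mathbf q=(q_1,\dots,q_k)$, where each $q_i=\sum_{\alpha\in\mathbb F_{n_i}^+}a_{i,\alpha}Z_\alpha$ is a positive regular polynomial in $n_i$ noncommuting indeterminates: a finite sum with $a_{i,\alpha}\ge0$, $a_{i,g_0^i}=0$ and $a_{i,g_j^i}>0$ for $j=1,\dots,n_i$. Define $\Phi_{q_i,X_i}(Y):=\sum_\alpha a_{i,\alpha}X_{i,\alpha}YX_{i,\alpha}^*$ for $Y\in B(\mathcal H)$. $B(\mathcal H)^{n_1}\times_c\cdots\times_cB(\mathcal H)^{n_k}$ is the set of $\mathbf X=(X_1,\dots,X_k)\in B(\mathcal H)^{n_1}\times\cdots\times B(\mathcal H)^{n_k}$ such that, for $s\ne t$, every entry of $X_s$ commutes with every entry of $X_t$. For $\mathbf p=(p_1,\dots,p_k)\in\{0,1\}^k$ let $\mathbf\Delta^{\mathbf p}_{\mathbf q,\mathbf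 X}:=(\mathrm{id}-\Phi_{q_1,X_1})^{p_1}\circ\cdots\circ(\mathrm{id}-\Phi_{q_k,X_k})^{p_k}$, where a zeroth power is the identity map on $B(\mathcal H)$, and let $\mathbf\Delta_{\mathbf q,\mathbf X}:=\mathbf\Delta^{(1,\dots,1)}_{\mathbf q,\mathbf X}$. Set $\mathbf D^-_{\mathbf q}(\mathcal H):=\{\mathbf X\in B(\mathcal H)^{n_1}\times_c\cdots\times_cB(\mathcal H)^{n_k}:\mathbf\Delta^{\mathbf p}_{\mathbf q,\mathbf X}(I)\ge0\text{ for all }\mathbf p\in\{0,1\}^k\}$ and $\mathbf D_{\mathbf q}(\mathcal H):=\{\mathbf X\in B(\mathcal H)^{n_1}\times_c\cdots\times_cB(\mathcal H)^{n_k}:\mathbf\Delta_{\mathbf q,\mathbf X}(I)>0\}$; $\mathbf D_{\mathbf q}(\mathcal H)^-$ is the operator norm closure of $\mathbf D_{\mathbf q}(\mathcal H)$. Reinhardt sets. $\mathbb D$ is the open unit disc of $\mathbb C$. For $\mathbf z=\{z_{i,j}\}\in\mathbb C^{n_1+\cdots+n_k}$ and $\mathbf X=\{X_{i,j}\}$, $\mathbf z\mathbf X:=\{z_{i,j}X_{i,j}\}$, and $r\mathbf X:=\{rX_{i,j}\}$ for $r\ge 0$; $\mathbf zG:=\{\mathbf z\mathbf X:\mathbf X\in G\}$ and similarly for $rG$. A set $G\subset B(\mathcal H)^{n_1}\times\cdots\times B(\mathcal H)^{n_k}$ is a complete Reinhardt set if $\mathbf z\mathbf X\in G$ for all $\mathbf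 X\in G$ and $\mathbf z\in\overline{\mathbb D}^{n_1+\cdots+n_k}$. A complete Reinhardt domain here is a relatively open (in $B(\mathcal H)^{n_1}\times_c\cdots\times_cB(\mathcal H)^{n_k}$) complete Reinhardt set.
   Formalization: D_q(H) is taken as the commuting X with Δ_{q,X}(I) > 0 and also Φ_{q_i,X_i}(I) ≤ I for every i; without this the claim fails for k ≥ 2 and H ≠ 0 (e.g. q_i = Z, X = (2,2)). For k = 1 nothing changes. *)

(* Defs.v *)
From HB Require Import structures.
From mathcomp Require Import all_boot all_order all_algebra finmap.
From mathcomp Require Import boolp classical_sets functions reals.
From mathcomp Require Import topology normedtype.
From mathcomp.real_closed Require Import complex.

Set Implicit Arguments.
Unset Strict Implicit.
Unset Printing Implicit Defensive.

Import Order.TTheory GRing.Theory Num.Theory.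
Import numFieldNormedType.Exports.

Local Open Scope classical_set_scope.
Local Open Scope ring_scope.
Local Open Scope complex_scope.

(* [inner] is linear in its first argument and conjugate-linear in the second. *)
HB.mixin Record CompleteNormedModule_isHilbert (R : realType) H
    & CompleteNormedModule R[i] H := {
  inner : {dot H for (@Num.conj R[i])};
  norm_inner : forall x : H, `|x| ^+ 2 = inner x x
}.

#[short(type="hilbertType")]
HB.structure Definition Hilbert (R : realType) :=
  {H of CompleteNormedModule R[i] H & CompleteNormedModule_isHilbert R H}.

Section BoundedOperators.
Context {R : realType} (V : normedModType R[i]).

Definition bounded_operator : {pred V -> V} := fun f =>
  `[< linear f /\ exists M : R[i], forall x, `|f x| <= M * `|x| >].

Record bop := Bop {bop_fun :> V -> V; _ : bop_fun \in bounded_operator}.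

HB.instance Definition _ := [isSub for bop_fun].
HB.instance Definition _ := [Choice of bop by <:].

Implicit Types f g h : bop.

Lemma bop_linear f : linear f.
Proof. by case: f => f /= /asboolP[]. Qed.

HB.instance Definition _ f :=
  GRing.isLinear.Build R[i] V V *:%R f (bop_linear f).

Lemma bop_bounded f : exists2 M : R, 0 <= M & forall x, `|f x| <= M%:C * `|x|.
Proof.
case: f => f /= /asboolP[_ [M fM]].
have [V0|] := pselect (forall x : V, x = 0).
  by exists 0 => // x; rewrite (V0 (f x)) (V0 x) normr0 mulr0.
move/existsNP => [x /eqP x0].
have M0 : 0 <= M.
  have := le_trans (normr_ge0 _) (fM x).
  by rewrite pmulr_lge0// normr_gt0.
by exists (complex.Re M); move: M0 fM; case: M => a b; rewrite lecE /= => /andP[/eqP-> ?].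
Qed.

Lemma bopP f g : f =1 g -> f = g.
Proof. by move=> fg; apply: val_inj; apply/funext. Qed.

Fact bounded_operator_submod_closed : submod_closed bounded_operator.
Proof.
split=> [|a f g].
  apply/asboolP; split=> [k x y|]; first by rewrite /= scaler0 addr0.
  by exists 0 => x; rewrite /= normr0 mul0r.
move=> /asboolP[lf [M fM]] /asboolP[lg [N gN]]; apply/asboolP; split.
  move=> k x y; rewrite -![(a *: f + g) _]/(a *: f _ + g _) lf lg.
  by rewrite !scalerDr !scalerA [k * a]mulrC addrACA.
exists (`|a| * M + N) => x.
rewrite mulrDl (le_trans (ler_normD _ _))// lerD//.
by rewrite normrZ -mulrA ler_wpM2l.
Qed.

HB.instance Definition _ := GRing.isSubmodClosed.Build _ _ bounded_operator
  bounded_operator_submod_closed.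
HB.instance Definition _ := [SubChoice_isSubLmodule of bop by <:].

Fact bounded_operator_id : (fun x : V => x) \in bounded_operator.
Proof. by apply/asboolP; split=> //; exists 1 => x; rewrite mul1r. Qed.

Fact bounded_operator_comp f g : f \o g \in bounded_operator.
Proof.
apply/asboolP; split=> [k x y|]; first by rewrite /= !linearP.
have [M M0 fM] := bop_bounded f; have [N N0 gN] := bop_bounded g.
exists (M%:C * N%:C) => x; apply: le_trans (fM _) _.
by rewrite -mulrA ler_wpM2l// lecR.
Qed.

Definition bop_id : bop := Bop bounded_operator_id.
Definition bop_comp f g : bop := Bop (bounded_operator_comp f g).

Lemma bopDE f g x : (f + g) x = f x + g x. Proof. by []. Qed.
Lemma bopNE f x : (- f) x = - f x. Proof. by []. Qed.
Lemma bopZE (a : R[i]) f x : (a *: f) x = a *: f x. Proof. by []. Qed.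
Lemma bop0E x : (0 : bop) x = 0. Proof. by []. Qed.

Let compA : associative bop_comp. Proof. by move=> f g h; exact: bopP. Qed.
Let comp1f : left_id bop_id bop_comp. Proof. by move=> f; exact: bopP. Qed.
Let compf1 : right_id bop_id bop_comp. Proof. by move=> f; exact: bopP. Qed.
Let compDl : left_distributive bop_comp +%R.
Proof. by move=> f g h; exact: bopP. Qed.
Let compDr : right_distributive bop_comp +%R.
Proof. by move=> f g h; apply: bopP => x; exact: (raddfD f). Qed.

HB.instance Definition _ := GRing.Zmodule_isPzRing.Build bop
  compA comp1f compf1 compDl compDr.

Lemma bopME f g x : (f * g) x = f (g x). Proof. by []. Qed.
Lemma bop1E x : (1 : bop) x = x. Proof. by []. Qed.

Definition opnorm f : R :=
  sup [set complex.Re `|f x| | x in [set x : V | `|x| <= 1]].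

Let ReK (x : V) : (complex.Re `|x|)%:C = `|x|.
Proof. by rewrite RRe_real// normr_real. Qed.

Let opnorm_has_sup f :
  has_sup [set complex.Re `|f x| | x in [set x : V | `|x| <= 1]].
Proof.
split; first by exists (complex.Re `|f 0|); exists 0; rewrite //= normr0.
have [M M0 fM] := bop_bounded f; exists M => _ [x /= x1 <-].
rewrite -lecR ReK (le_trans (fM x))//.
by rewrite -[leRHS]mulr1 ler_wpM2l// lecR.
Qed.

Lemma opnorm_ge0 f : 0 <= opnorm f.
Proof.
apply: ub_le_sup; first by case: (opnorm_has_sup f).
by exists 0; rewrite /= ?linear0 ?normr0.
Qed.

Lemma opnormP f x : `|f x| <= (opnorm f)%:C * `|x|.
Proof.
have [->|x0] := eqVneq x 0; first by rewrite linear0 !normr0 mulr0.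
have nx0 : 0 < `|x| by rewrite normr_gt0.
rewrite -ler_pdivrMr// mulrC.
have -> : `|x|^-1 * `|f x| = `|f (`|x|^-1 *: x)|.
  by rewrite linearZ normrZ normfV normr_id.
rewrite -ReK lecR; apply: ub_le_sup; first by case: (opnorm_has_sup f).
by exists (`|x|^-1 *: x) => //=; rewrite normrZ normfV normr_id mulVf ?gt_eqF.
Qed.

Lemma opnorm_le f (M : R) :
  0 <= M -> (forall x, `|f x| <= M%:C * `|x|) -> opnorm f <= M.
Proof.
move=> M0 fM; apply: ge_sup; first by case: (opnorm_has_sup f).
move=> _ [x /= x1 <-]; rewrite -lecR ReK (le_trans (fM x))//.
by rewrite -[leRHS]mulr1 ler_wpM2l// lecR.
Qed.

Let bop_norm f : R[i] := (opnorm f)%:C.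

Let bop_normD f g : bop_norm (f + g) <= bop_norm f + bop_norm g.
Proof.
rewrite /bop_norm -rmorphD lecR.
apply: opnorm_le; first by rewrite addr_ge0 ?opnorm_ge0.
move=> x; rewrite rmorphD/= mulrDl (le_trans (ler_normD _ _))//.
by rewrite lerD// opnormP.
Qed.

Let bop_normZ (a : R[i]) f : bop_norm (a *: f) = `|a| * bop_norm f.
Proof.
have na : `|a| = (complex.Re `|a|)%:C by rewrite RRe_real// normr_real.
have na0 : 0 <= complex.Re `|a| by rewrite -lecR -na; exact: normr_ge0.
rewrite na /bop_norm -rmorphM; congr (_%:C); apply/le_anti/andP; split.
  apply: opnorm_le => [|x]; first by rewrite mulr_ge0 ?opnorm_ge0.
  by rewrite rmorphM/= -na normrZ -mulrA ler_wpM2l// opnormP.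
have [->|a0] := eqVneq a 0; first by rewrite normr0/= mul0r opnorm_ge0.
have na_gt0 : 0 < complex.Re `|a| by rewrite -ltcR -na; move: a0; rewrite -normr_gt0.
rewrite mulrC -ler_pdivlMr//.
apply: opnorm_le => [|x]; first by rewrite divr_ge0 ?opnorm_ge0.
rewrite rmorphM/= mulrAC fmorphV/= -na ler_pdivlMr ?normr_gt0// mulrC -normrZ.
exact: (opnormP (a *: f)).
Qed.

Let bop_norm_eq0 f : bop_norm f = 0 -> f = 0.
Proof.
move=> f0; apply: bopP => x; apply/eqP; rewrite -normr_le0.
by rewrite (le_trans (opnormP _ _))// -/(bop_norm f) f0 mul0r.
Qed.

HB.instance Definition _ :=
  Lmodule_isNormed.Build R[i] bop bop_normD bop_normZ bop_norm_eq0.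

Lemma bop_normE f : `|f| = (opnorm f)%:C. Proof. by []. Qed.

End BoundedOperators.

Section HilbertOperators.
Context {R : realType} {H : hilbertType R}.
Implicit Types A B : bop H.

(* The adjoint exists and is unique by the Riesz representation theorem. *)
Definition adjoint A : bop H :=
  xget 0 [set B : bop H | forall x y, inner (A x) y = inner x (B y)].

(* For w : R[i], [0 <= w] means that w is real and nonnegative. *)
Definition op_ge0 A := forall x, 0 <= inner (A x) x.

Definition op_gt0 A := op_ge0 A /\ exists B, A * B = 1 /\ B * A = 1.

End HilbertOperators.

(* A polynomial in n noncommuting indeterminates is the finitely supported
   family of its coefficients, indexed by words in the letters 'I_n (the free
   monoid on n generators); [::] is the empty word. *)
Definition ncpoly (R : realType) (n : nat) := {fsfun seq 'I_n -> R with 0}.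

Definition positive_regular (R : realType) (n : nat) (a : ncpoly R n) :=
  [/\ forall w, 0 <= a w, a [::] = 0 & forall j, 0 < a [:: j]].

Section PolydomainDefs.
Context {R : realType} (H : hilbertType R).

Definition word_op (n : nat) (X : 'I_n -> bop H) (w : seq 'I_n) : bop H :=
  \prod_(j <- w) X j.

Definition Phi (n : nat) (a : ncpoly R n) (X : 'I_n -> bop H) (Y : bop H) :=
  \sum_(w <- finsupp a)
    (a w)%:C *: (word_op X w * Y * adjoint (word_op X w)).

Context {k : nat} {n : 'I_k -> nat}.

(* As there are finitely many coordinates, the product topology is the operator
   norm topology. *)
Definition op_tuple :=
  prod_topology (fun i : 'I_k => {ptws 'I_(n i) -> bop H}).

Implicit Types (X : op_tuple) (G : set op_tuple).

Definition commuting_tuples : set op_tuple :=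
  [set X | forall s t, s != t -> forall j l, X s j * X t l = X t l * X s j].

Definition relatively_open G :=
  exists2 U : set op_tuple, open U & G = commuting_tuples `&` U.

Section Polydomain.
Variable q : forall i, ncpoly R (n i).

Definition Delta (p : 'I_k -> bool) X : bop H -> bop H :=
  \big[(fun f g => f \o g)/id]_(i < k)
    iter (p i) (fun Y => Y - Phi (q i) (X i) Y).

Definition polydomain_minus : set op_tuple :=
  [set X | commuting_tuples X /\ forall p, op_ge0 (Delta p X 1)].

Definition defect_domain : set op_tuple :=
  [set X | commuting_tuples X /\ op_gt0 (Delta (fun=> true) X 1)].

(* For k >= 2 and H != 0, [defect_domain] is never contained in
   [polydomain_minus]: an even number of negative factors id - Phi_i still gives
   a positive product, see [defect_domain_not_subset]. As for the noncommutative
   polyball, the polydomain consists of the tuples of [defect_domain] each of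
   whose blocks X_i satisfies Phi_i(I) <= I. For k = 1 this changes nothing, see
   [polydomain1]. *)
Definition polydomain : set op_tuple :=
  [set X | defect_domain X /\ forall i, op_ge0 (1 - Phi (q i) (X i) 1)].

End Polydomain.

Definition cscale (z : forall i, 'I_(n i) -> R[i]) X : op_tuple :=
  fun i j => z i j *: X i j.

Definition rscale (r : R) X : op_tuple := fun i j => r%:C *: X i j.

Definition closed_polydisc : set (forall i, 'I_(n i) -> R[i]) :=
  [set z | forall i j, `|z i j| <= 1].

Definition open_polydisc : set (forall i, 'I_(n i) -> R[i]) :=
  [set z | forall i j, `|z i j| < 1].

Definition complete_reinhardt G :=
  forall X z, G X -> closed_polydisc z -> G (cscale z X).

Definition complete_reinhardt_domain G :=
  relatively_open G /\ complete_reinhardt G.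

End PolydomainDefs.

Section ScalarTuples.
Context {R : realType} (H : hilbertType R).

Let sc (c : R) : bop H := c%:C *: (1 : bop H).

Let scD a b : sc (a + b) = sc a + sc b.
Proof. by rewrite /sc rmorphD scalerDl. Qed.

Let scM a b : sc (a * b) = sc a * sc b.
Proof. by apply: bopP => x; rewrite bopME !bopZE !bop1E rmorphM/= scalerA. Qed.

Let inner_sc c (x : H) : inner (sc c x) x = c%:C * `|x| ^+ 2.
Proof. by rewrite bopZE bop1E norm_inner linearZl_LR. Qed.

Let scE c (x : H) : sc c x = c%:C *: x.
Proof. by []. Qed.

Let adjoint_sc c : adjoint (sc c) = sc c.
Proof.
have scP x y : inner (sc c x) y = inner x (sc c y).
  rewrite !scE linearZl_LR linearZr_LR /=.
  by congr (_ * _); rewrite conj_Creal// complex_real.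
apply: bopP => y; rewrite /adjoint.
have := @xgetPex _ 0 [set B : bop H | forall x y, inner (sc c x) y = inner x (B y)]
  (ex_intro _ (sc c) scP); set B := xget _ _ => /= BP.
have uu : inner (B y - sc c y) (B y - sc c y) = 0.
  by rewrite linearBr /= -BP scP subrr.
by apply/eqP; rewrite -subr_eq0 -normr_eq0 -sqrf_eq0 norm_inner uu.
Qed.

Let peval n (a : ncpoly R n) (c : R) := \sum_(w <- finsupp a) a w * (c ^+ size w * c ^+ size w).

Let Phi_sc n (a : ncpoly R n) c l :
  Phi a (fun=> sc c) (sc l) = sc (peval a c * l).
Proof.
rewrite /Phi /peval mulr_suml.
rewrite [RHS](big_morph sc scD (_ : sc 0 = 0)); last by rewrite /sc scale0r.
apply: eq_bigr => w _.
have -> : word_op (fun=> sc c) w = sc (c ^+ size w).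
  rewrite /word_op; elim: w => [|j w IH]; first by rewrite big_nil /sc scale1r.
  by rewrite big_cons IH -scM exprS.
rewrite adjoint_sc -!scM {1}/sc scalerA -rmorphM/= -/(sc _).
by congr sc; rewrite -[RHS]mulrA [_ * _ * l]mulrAC.
Qed.

Let Delta_sc k (n : 'I_k -> nat) (q : forall i, ncpoly R (n i)) c p :
  Delta q p (fun i _ => sc (c i)) 1 =
  sc (\prod_(i < k) (1 - peval (q i) (c i)) ^+ p i).
Proof.
suff E l : Delta q p (fun i _ => sc (c i)) (sc l) =
    sc (\prod_(i < k) (1 - peval (q i) (c i)) ^+ p i * l).
  have sc1 : sc 1 = 1 by rewrite /sc scale1r.
  by rewrite -sc1 E mulr1.
rewrite /Delta.
elim: (index_enum _) => [|i s IH]; first by rewrite !big_nil mul1r.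
rewrite !big_cons /= IH; case: (p i) => /=; last by rewrite expr0 mul1r.
rewrite expr1 Phi_sc.
by rewrite -!mulrA mulrBl mul1r scD /sc rmorphN scaleNr.
Qed.

Lemma defect_domain_not_subset (k : nat) (n : 'I_k -> nat)
    (q : forall i, ncpoly R (n i)) (s t : 'I_k) (x : H) :
  (forall i, (0 < n i)%N) -> (forall i, positive_regular (q i)) ->
  s != t -> x != 0 ->
  ~ (@defect_domain R H k n q `<=` polydomain_minus q).
Proof.
move=> n0 qreg st x0.
pose a i := q i [:: Ordinal (n0 i)].
have a0 i : 0 < a i by have [_ _] := qreg i; exact.
pose b : R := 1 + (a s)^-1 + (a t)^-1.
have b1 : 1 <= b.
  by rewrite /b -addrA lerDl addr_ge0 ?invr_ge0 ?ltW.
have large i : 1 < a i * b -> 1 < peval (q i) b.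
  move=> ab; have [qi0 _ qi1] := qreg i.
  have wq : [:: Ordinal (n0 i)] \in finsupp (q i).
    by rewrite mem_finsupp gt_eqF.
  rewrite /peval (big_fsetD1 _ wq) /= -/(a i).
  apply: (lt_le_trans ab); rewrite !expr1.
  apply: (@le_trans _ _ (a i * (b * b))).
    by rewrite ler_wpM2l ?(ltW (a0 i))// ler_peMr ?(le_trans ler01 b1).
  rewrite lerDl sumr_ge0// => w _; rewrite mulr_ge0// -expr2.
  exact: sqr_ge0.
have as0 := a0 s; have at0 := a0 t.
have qs : 1 < peval (q s) b.
  apply: large; rewrite /b !mulrDr mulr1 divff ?gt_eqF//.
  rewrite -addrA [_ + (1 + _)]addrCA ltrDl addr_gt0//.
  by rewrite mulr_gt0 ?invr_gt0.
have qt : 1 < peval (q t) b.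
  apply: large; rewrite /b !mulrDr mulr1 divff ?gt_eqF//.
  by rewrite ltrDr addr_gt0// mulr_gt0 ?invr_gt0.
pose c i := if (i == s) || (i == t) then b else 0.
pose X : @op_tuple R H k n := fun i _ => sc (c i).
have q0 i : i != s -> i != t -> peval (q i) (c i) = 0.
  move=> /negPf is_ /negPf it; rewrite /c is_ it /= /peval big1_seq// => w _.
  have [_ q0 _] := qreg i.
  by case: w => [|j w]; rewrite ?q0 ?mul0r//= expr0n/= mul0r mulr0.
move/(_ X); case.
  split; first by move=> i i' _ j j'; rewrite /X -!scM mulrC.
  rewrite Delta_sc; set l := \prod_(_ < _) _.
  have l0 : 0 < l.
    rewrite /l (bigD1 s)//= (bigD1 t) 1?eq_sym//= big1 => [|i /andP[is_ it]].
      rewrite mulr1 !expr1 /c !eqxx orbT /=.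
      by rewrite nmulr_rgt0 subr_lt0.
    by rewrite q0// subr0 expr1.
  split=> [y|]; first by rewrite inner_sc mulr_ge0 ?exprn_ge0// lecR ltW.
  exists (sc l^-1); rewrite -!scM divff ?mulVf ?gt_eqF//.
  by rewrite /sc scale1r.
move=> _ /(_ (fun i => i == s) x); rewrite Delta_sc.
rewrite (bigD1 s)//= big1 => [|i /negPf ->]; last by rewrite expr0.
rewrite eqxx expr1 mulr1 /c eqxx inner_sc pmulr_lge0; last first.
  by rewrite exprn_gt0// normr_gt0.
by rewrite lecR subr_ge0 leNgt qs.
Qed.

End ScalarTuples.

Lemma polydomain1 (R : realType) (H : hilbertType R) (n : 'I_1 -> nat)
    (q : forall i, ncpoly R (n i)) :
  @polydomain R H 1 n q = defect_domain q.
Proof.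
apply/seteqP; split=> [X []//|X XD]; split=> // i.
have [_ [+ _]] := XD.
by rewrite /Delta big_ord_recl big_ord0 /= !ord1.
Qed.

(* Main.v *)
Require Import Defs.
From mathcomp Require Import all_boot all_order all_algebra finmap.
From mathcomp Require Import boolp classical_sets functions reals.
From mathcomp Require Import topology normedtype.
From mathcomp.real_closed Require Import complex.
From mathcomp Require Import ring lra.

Set Implicit Arguments.
Unset Strict Implicit.
Unset Printing Implicit Defensive.

Import Order.TTheory GRing.Theory Num.Theory.
Import numFieldNormedType.Exports.

Local Open Scope classical_set_scope.
Local Open Scope ring_scope.
Local Open Scope complex_scope.

(** The proof rests on a description of both domains by families of
inequalities.  Write Phi_i for the completely positive map attached to the
i-th block of a commuting tuple X.  The maps Phi_i commute, so the product of
the maps id - Phi_i over a duplicate-free list u of blocks, applied to I,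
depends only on the underlying set of u; call the result the defect of u.
Every defect is self-adjoint, and

  - X lies in the closed domain iff all its defects are >= 0;
  - X lies in the open domain iff all its defects are >= c I for a common c > 0.

In the second equivalence ([polydomainP]) only the full defect is known to be
positive and invertible, hence bounded below by some c I with c > 0
([op_gt0_bounded_below]).  One factor id - Phi_i is then removed at a time:
if Phi_i(I) <= I and Z - Phi_i(Z) >= c I, then Z >= c I
([coercive_defect_bounded_below]).  Indeed Z >= - t I with t >= 0 implies
Phi_i(Z) >= - t I, hence Z >= (c - t) I; starting from t = |Z| and iterating,
one reaches Z >= 0, hence Phi_i(Z) >= 0 and finally Z >= c I.  Conversely a
self-adjoint operator bounded below by c > 0 is invertible
([bounded_below_op_gt0]).

Scaling.  If |z_{i,j}| <= r <= 1, the map Psi_i of the block z_i X_i is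
dominated by r Phi_i on positive operators, because q_i has nonnegative
coefficients and no constant term.  For Z >= 0 this gives
  Z - Psi_i(Z) >= (1 - r) Z + r (Z - Phi_i(Z)).
Replacing the Phi_i by the Psi_i one block at a time, every mixed defect keeps
the common lower bound of the defects of X; with r = 1 this shows that both
domains are complete Reinhardt sets.  If r < 1 and the defects of X are only
>= 0, the first summand still yields the lower bound (1 - r)^|u| for the defect
of u ([strict_defect_bounded_below]), so z X lies in the open domain.

Topology.  Defects depend continuously on X in norm, and a lower bound c of a
quadratic form moves by at most the size of the perturbation.  Hence the open
domain is relatively open and the closed one is closed; r X -> X for r -> 1
gives both the density of the open domain in the closed one and the
representation of each X in the open domain as r Y with r < 1 and Y in the
open domain.

All this needs a genuine adjoint, that is, the Riesz representation theorem.
It and the invertibility of coercive self-adjoint operators are both instances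
of one minimisation argument, [coercive_weak_solution]. *)

(** * The real part of the inner product *)

Section RealInnerProduct.
Context {R : realType} {H : hilbertType R}.
Implicit Types x y v : H.

(** Norms of complex normed modules take their values in R[i]; [rnorm] and
[rinner] bring estimates back to the ordered field R. *)
Definition rnorm {V : normedModType R[i]} (x : V) : R := complex.Re `|x|.

Lemma rnormE (V : normedModType R[i]) (x : V) : (rnorm x)%:C = `|x|.
Proof. by rewrite RRe_real// normr_real. Qed.

Lemma rnorm_ge0 (V : normedModType R[i]) (x : V) : 0 <= rnorm x.
Proof. by rewrite -lecR rnormE normr_ge0. Qed.

Definition rinner x y : R := complex.Re (inner x y).

Lemma innerC x y : inner x y = Num.conj (inner y x).
Proof. by rewrite hermC /= expr0 mul1r. Qed.

Lemma rinnerC x y : rinner x y = rinner y x.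
Proof. by rewrite /rinner innerC; case: (inner y x). Qed.

Lemma rinnerDl x y v : rinner (x + y) v = rinner x v + rinner y v.
Proof. by rewrite /rinner linearDl raddfD. Qed.

Lemma rinnerZl (a : R) x v : rinner (a%:C *: x) v = a * rinner x v.
Proof.
by rewrite /rinner linearZl_LR /=; case: (inner x v) => u w /=; rewrite mul0r subr0.
Qed.

Lemma rinnerNl x v : rinner (- x) v = - rinner x v.
Proof. by rewrite /rinner linearNl raddfN. Qed.

Lemma rinnerBl x y v : rinner (x - y) v = rinner x v - rinner y v.
Proof. by rewrite rinnerDl rinnerNl. Qed.

Lemma rinnerDr x y v : rinner v (x + y) = rinner v x + rinner v y.
Proof. by rewrite ![rinner v _]rinnerC rinnerDl. Qed.

Lemma rinnerBr x y v : rinner v (x - y) = rinner v x - rinner v y.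
Proof. by rewrite ![rinner v _]rinnerC rinnerBl. Qed.

Lemma rinnerZr (a : R) x v : rinner v (a%:C *: x) = a * rinner v x.
Proof. by rewrite ![rinner v _]rinnerC rinnerZl. Qed.

Lemma rinnerxx x : rinner x x = rnorm x ^+ 2.
Proof.
by rewrite /rinner -norm_inner -rnormE -rmorphXn.
Qed.

Lemma rnorm_eq0 (V : normedModType R[i]) (x : V) : (rnorm x == 0) = (x == 0).
Proof. by rewrite -[in RHS]normr_eq0 -rnormE fmorph_eq0. Qed.

Lemma rnorm_gt0 (V : normedModType R[i]) (x : V) : (0 < rnorm x) = (x != 0).
Proof. by rewrite lt_neqAle eq_sym rnorm_eq0 rnorm_ge0 andbT. Qed.

Lemma rnormN (V : normedModType R[i]) (x : V) : rnorm (- x) = rnorm x.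
Proof. by rewrite /rnorm normrN. Qed.

Lemma rnormB (V : normedModType R[i]) (x y : V) : rnorm (x - y) = rnorm (y - x).
Proof. by rewrite -rnormN opprB. Qed.

Lemma rnormD (V : normedModType R[i]) (x y : V) :
  rnorm (x + y) <= rnorm x + rnorm y.
Proof. by rewrite -lecR rmorphD /= !rnormE ler_normD. Qed.

Lemma rnorm_complex (r : R) : 0 <= r -> `|r%:C| = r%:C :> R[i].
Proof. by move=> r0; rewrite ger0_norm// lecR. Qed.

Lemma gt0_complexP (e : R[i]) : 0 < e -> exists2 d : R, 0 < d & e = d%:C.
Proof.
move=> e0; have ee : e = (complex.Re e)%:C by rewrite RRe_real// gtr0_real.
by exists (complex.Re e) => //; rewrite -ltcR -ee.
Qed.

Lemma rnorm0 (V : normedModType R[i]) : rnorm (0 : V) = 0.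
Proof. by rewrite /rnorm normr0. Qed.

Lemma rinner_cauchy_schwarz x y : rinner x y <= rnorm x * rnorm y.
Proof.
have [->|x0] := eqVneq x 0.
  by rewrite /rinner linear0l /= mulr_ge0 ?rnorm_ge0.
have [->|y0] := eqVneq y 0.
  by rewrite /rinner linear0r /= mulr_ge0 ?rnorm_ge0.
have nx0 : 0 < rnorm x by rewrite rnorm_gt0.
have ny0 : 0 < rnorm y by rewrite rnorm_gt0.
(* |u|^2 = 2 |x| |y| (|x| |y| - Re <x, y>). *)
pose u := (rnorm y)%:C *: x - (rnorm x)%:C *: y.
have : 0 <= rinner u u by rewrite rinnerxx sqr_ge0.
rewrite rinnerBl !rinnerBr !rinnerZl !rinnerZr !rinnerxx (rinnerC y x).
move: nx0 ny0; set a := rnorm x; set b := rnorm y; set p := rinner x y.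
move=> a0 b0 h; have ab0 : 0 < a * b by rewrite mulr_gt0.
rewrite -(ler_pM2l ab0); nra.
Qed.

Lemma rinner_abs x y : `|rinner x y| <= rnorm x * rnorm y.
Proof.
rewrite ler_norml rinner_cauchy_schwarz andbT lerNl -rinnerNl.
apply: le_trans (rinner_cauchy_schwarz _ _) _.
by rewrite rnormN.
Qed.

End RealInnerProduct.

(** * Weak solutions of coercive equations *)

Section Coercive.
Context {R : realType} {H : hilbertType R}.
Implicit Types (x y v : H) (A B S : bop H).

Lemma rnormM (V : normedModType R[i]) (A : bop V) (x : V) :
  rnorm (A x) <= rnorm A * rnorm x.
Proof. by rewrite -lecR rmorphM /= !rnormE bop_normE opnormP. Qed.

Lemma bop_morphD A x y : A (x + y) = A x + A y. Proof. exact: linearD. Qed.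

Lemma bop_morphB A x y : A (x - y) = A x - A y. Proof. exact: linearB. Qed.

Lemma bop_morphZ A a x : A (a *: x) = a *: A x. Proof. exact: linearZ. Qed.

Definition symmetric_op A := forall x y, inner (A x) y = inner x (A y).

Definition quad A x : R := rinner (A x) x.

Definition bounded_below (c : R) A := forall x, c * rnorm x ^+ 2 <= quad A x.

Lemma rsymmetric A : symmetric_op A ->
  forall x y, rinner (A x) y = rinner x (A y).
Proof. by move=> sA x y; rewrite /rinner sA. Qed.

(** The solution x minimises J v = <A v, v> - 2 Re <S v, y>.  Coercivity bounds
J from below and, through the parallelogram identity, makes minimising
families Cauchy; completeness provides x, and the vanishing of the first
variation of J at x is the real part of the claim.  Replacing v by i v gives
the imaginary part.  For A = 1 this is the Riesz representation of
v |-> <S v, y>; for S = 1 it says that A is onto. *)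
Lemma coercive_weak_solution A S (c : R) y :
  symmetric_op A -> 0 < c -> bounded_below c A ->
  exists x, forall v, inner (S v) y = inner v (A x).
Proof.
move=> sA c0 cA; have rA := rsymmetric sA.
pose J x := quad A x - 2 * rinner (S x) y.
pose L := rnorm S * rnorm y.
have L0 : 0 <= L by rewrite mulr_ge0 ?rnorm_ge0.
have Jlb x : - (L ^+ 2 / c) <= J x.
  have h1 : rinner (S x) y <= L * rnorm x.
    apply: le_trans (rinner_cauchy_schwarz _ _) _.
    by rewrite /L mulrAC ler_wpM2r ?rnorm_ge0// rnormM.
  have h2 := cA x; rewrite /J; set a := rnorm x in h1 h2.
  have -> : L ^+ 2 / c = c * (L / c) ^+ 2 by field; rewrite gt_eqF.
  have h3 : L = c * (L / c) by rewrite mulrC divfK ?gt_eqF.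
  set l := L / c in h3 *; rewrite h3 in h1.
  by have := mulr_ge0 (ltW c0) (sqr_ge0 (a - l)); lra.
pose E := range J.
have Einf : has_inf E.
  split; first by exists (J 0); exists 0.
  by exists (- (L ^+ 2 / c)) => _ [x _ <-].
pose m := inf E.
have mJ x : m <= J x by apply: ge_inf; [case: Einf|exists x].
have parallelogram x z :
    quad A (x - z) = 2 * J x + 2 * J z - 4 * J (2^-1%:C *: (x + z)).
  rewrite /J /quad !(bop_morphB, bop_morphD, bop_morphZ).
  rewrite !(rinnerBl, rinnerBr, rinnerDl, rinnerDr, rinnerZl, rinnerZr).
  by rewrite (rA z x) (rinnerC z (A x)); field.
have near_min e x z : J x < m + e -> J z < m + e ->
    c * rnorm (x - z) ^+ 2 <= 4 * e.
  by move=> Jx Jz; have := cA (x - z); have := mJ (2^-1%:C *: (x + z));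
    rewrite parallelogram; lra.
(* F is the filter of minimising families. *)
pose F := filter_from [set e : R | 0 < e] (fun e => [set x | J x < m + e]).
have FF : ProperFilter F.
  apply: filter_from_proper; last first.
    move=> e /= e0; have [_ [x _ <-]] := inf_adherent e0 Einf.
    by exists x.
  apply: filter_from_filter; first by exists 1 => /=.
  move=> e1 e2 /= e10 e20; exists (Num.min e1 e2); first by rewrite /= lt_min e10.
  move=> x /=; rewrite -ltrBlDl lt_min => /andP[h1 h2].
  by split; rewrite -ltrBlDl.
have Fc : cvg F.
  apply/cauchy_cvgP/cauchy_exP => _ /gt0_complexP[d d0 ->].
  pose e' := c * d ^+ 2 / 8.
  have e'0 : 0 < e' by rewrite /e' divr_gt0 ?mulr_gt0 ?exprn_gt0.
  have [_ [x _ <-] Jx] := inf_adherent e'0 Einf.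
  exists x, e' => // z /= Jz; rewrite -ball_normE /= -rnormE ltcR.
  have := near_min _ _ _ Jx Jz; rewrite /e'.
  rewrite -(@ltr_pXn2r _ 2) ?nnegrE ?rnorm_ge0 ?(ltW d0)// => h.
  rewrite -(ltr_pM2l c0); have := mulr_gt0 c0 (exprn_gt0 2 d0); lra.
move/cvg_ex : Fc => [l Fl]; exists l.
have key v : rinner (S v) y = rinner v (A l).
  pose g := rinner v (A l) - rinner (S v) y.
  (* J (l + t v) - J l = 2 t g + t^2 <A v, v> is nonnegative for every t. *)
  suff tg t : 0 <= 2 * t * g + t ^+ 2 * quad A v.
    suff : g = 0 by move/eqP; rewrite subr_eq0 => /eqP.
    have q0 : 0 <= quad A v.
      by apply: le_trans (cA v); rewrite mulr_ge0 ?sqr_ge0// ltW.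
    have := tg (- (g / (quad A v + 1))); set w := quad A v in q0 *.
    have w0 : 0 < w + 1 by lra.
    have -> : g = (g / (w + 1)) * (w + 1) by rewrite divfK ?gt_eqF.
    rewrite mulfK ?gt_eqF//; move: (g / (w + 1)) => h.
    have -> : 2 * - h * (h * (w + 1)) + (- h) ^+ 2 * w = - (h ^+ 2 * (w + 2)) by ring.
    rewrite oppr_ge0 pmulr_lle0; last by lra.
    move=> h0; have : h ^+ 2 == 0 by rewrite eq_le h0 sqr_ge0.
    by rewrite sqrf_eq0 => /eqP ->; rewrite mul0r.
  rewrite -oppr_le0; apply/ler_addgt0Pr => e e0; rewrite add0r.
  (* l is approximated by a point x where J is almost minimal; d makes the
     resulting error in the linear term at most e / 2. *)
  pose d := e / (4 * (`|t| * rnorm (A v) + 1)).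
  have d0 : 0 < d.
    by rewrite divr_gt0// mulr_gt0// ltr_wpDl// mulr_ge0 ?rnorm_ge0.
  have e20 : 0 < e / 2 by rewrite divr_gt0.
  have [x [Jx lx]] : exists x, J x < m + e / 2 /\ rnorm (x - l) < d.
    have d0' : 0 < d%:C by rewrite ltcR.
    have Fd : F [set x | `|l - x| < d%:C].
      by move/fcvgrPdist_lt : Fl; apply.
    have Fe : F [set x | J x < m + e / 2] by exists (e / 2).
    have [x [h1 h2]] := filter_ex (filterI Fe Fd).
    by exists x; split => //; rewrite -ltcR rnormE distrC.
  have := mJ (x + t%:C *: v); rewrite /J /quad !(bop_morphD, bop_morphZ).
  rewrite !(rinnerDl, rinnerDr, rinnerZl, rinnerZr) rA (rinnerC (A v) x).
  move: Jx; rewrite /J /quad => Jx.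
  have hx : rinner x (A v) = rinner v (A l) + rinner (x - l) (A v).
    by rewrite rinnerBl -(rA l v) (rinnerC (A l)) addrCA subrr addr0.
  have hd : `|t| * `|rinner (x - l) (A v)| <= e / 4.
    apply: (@le_trans _ _ (`|t| * (d * rnorm (A v)))).
      rewrite ler_wpM2l//; apply: le_trans (rinner_abs _ _) _.
      by rewrite ler_wpM2r ?rnorm_ge0// ltW.
    rewrite /d; set w := `|t| * rnorm (A v).
    have w0 : 0 <= w by rewrite mulr_ge0 ?rnorm_ge0.
    rewrite mulrCA -/w mulrAC ler_pdivrMr ?mulr_gt0 ?ltr_wpDl//.
    nra.
  move: hd; rewrite -normrM ler_norml => /andP[_ hd].
  by rewrite -(rA x x) (rA x v) hx /g; lra.
(* The real parts agree for v and for i v. *)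
move=> v; have k1 := key v; have k2 := key ('i *: v).
move: k1 k2; rewrite /rinner bop_morphZ !linearZl_LR /=.
case: (inner (S v) y) => a b; case: (inner v (A l)) => a' b' /= ->.
by rewrite !mul0r !mul1r !sub0r => /oppr_inj ->.
Qed.

End Coercive.

(** * Adjoints *)

Section Adjoint.
Context {R : realType} {H : hilbertType R}.
Implicit Types (x y v : H) (A B S : bop H).

Lemma inner_inj x y : (forall v, inner v x = inner v y) -> x = y.
Proof.
move=> xy; apply/eqP; rewrite -subr_eq0 -normr_eq0 -sqrf_eq0 norm_inner.
by rewrite linearBr /= xy subrr.
Qed.

Lemma quad1 x : quad (1 : bop H) x = rnorm x ^+ 2.
Proof. by rewrite /quad bop1E rinnerxx. Qed.

Lemma transpose_bound A y z : (forall x, inner (A x) y = inner x z) ->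
  rnorm z <= rnorm A * rnorm y.
Proof.
move=> Ayz; have [->|z0] := eqVneq z 0.
  by rewrite rnorm0 mulr_ge0 ?rnorm_ge0.
have nz0 : 0 < rnorm z by rewrite rnorm_gt0.
rewrite -(ler_pM2l nz0) -expr2 -rinnerxx /rinner -Ayz.
apply: le_trans (rinner_cauchy_schwarz _ _) _.
by rewrite mulrA ler_wpM2r ?rnorm_ge0// mulrC rnormM.
Qed.

Lemma bounded_operatorI (f : H -> H) (M : R) :
  linear f -> (forall x, rnorm (f x) <= M * rnorm x) ->
  f \in @bounded_operator R H.
Proof.
move=> lf fM; apply/asboolP; split => //; exists M%:C => x.
by rewrite -!rnormE -rmorphM lecR.
Qed.

Lemma adjoint_exists A :
  exists B : bop H, forall x y, inner (A x) y = inner x (B y).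
Proof.
have s1 : symmetric_op (1 : bop H) by [].
have b1 : bounded_below 1 (1 : bop H) by move=> x; rewrite quad1 mul1r.
have /choice[f fP] : forall y, exists z, forall v, inner (A v) y = inner v z.
  by move=> y; have [z zP] := coercive_weak_solution A y s1 ltr01 b1; exists z.
have lf : linear f.
  move=> a y z; apply: inner_inj => v.
  by rewrite -fP linearDr /= linearZr_LR /= !fP linearDr /= linearZr_LR.
have bf y : rnorm (f y) <= rnorm A * rnorm y by exact: transpose_bound.
by exists (Bop (bounded_operatorI lf bf)).
Qed.

Lemma adjointP A x y : inner (A x) y = inner x (adjoint A y).
Proof.
rewrite /adjoint; have [B BP] := adjoint_exists A.
exact: (@xgetPex _ 0 [set B : bop H | forall x y, inner (A x) y = inner x (B y)]
  (ex_intro _ B BP)).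
Qed.

Lemma adjoint_eq A B :
  (forall x y, inner (A x) y = inner x (B y)) -> adjoint A = B.
Proof. by move=> AB; apply: bopP => y; apply: inner_inj => v; rewrite -adjointP. Qed.

Lemma adjointM A B : adjoint (A * B) = adjoint B * adjoint A.
Proof. by apply: adjoint_eq => x y; rewrite !bopME !adjointP. Qed.

Lemma adjointB A B : adjoint (A - B) = adjoint A - adjoint B.
Proof.
apply: adjoint_eq => x y.
by rewrite !bopDE !bopNE linearBl linearBr /= !adjointP.
Qed.

Lemma adjointZ (a : R[i]) A : adjoint (a *: A) = Num.conj a *: adjoint A.
Proof.
apply: adjoint_eq => x y; rewrite !bopZE linearZl_LR linearZr_LR /= adjointP.
by rewrite conjCK.
Qed.

Lemma rnorm_adjoint A : rnorm (adjoint A) <= rnorm A.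
Proof.
rewrite {1}/rnorm bop_normE /=; apply: opnorm_le => [|y]; first exact: rnorm_ge0.
rewrite -!rnormE -rmorphM lecR; apply: transpose_bound => x.
exact: adjointP.
Qed.

Lemma symmetric_conj A B : symmetric_op A -> symmetric_op (B * A * adjoint B).
Proof.
move=> sA x y; rewrite !bopME adjointP sA.
by rewrite [RHS]innerC (adjointP B) -innerC.
Qed.

End Adjoint.

(** * Lower bounds of quadratic forms *)

Section Positivity.
Context {R : realType} {H : hilbertType R}.
Implicit Types (x y v : H) (A B C : bop H) (a c d : R).

Lemma symmetric1 : symmetric_op (1 : bop H). Proof. by []. Qed.

Lemma symmetric0 : symmetric_op (0 : bop H).
Proof. by move=> x y; rewrite bop0E linear0l linear0r. Qed.

Lemma symmetricD A B : symmetric_op A -> symmetric_op B -> symmetric_op (A + B).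
Proof. by move=> sA sB x y; rewrite !bopDE linearDl linearDr /= sA sB. Qed.

Lemma symmetricZ a A : symmetric_op A -> symmetric_op (a%:C *: A).
Proof.
move=> sA x y; rewrite !bopZE linearZl_LR linearZr_LR /= sA.
by rewrite conj_Creal// complex_real.
Qed.

Lemma symmetricB A B : symmetric_op A -> symmetric_op B -> symmetric_op (A - B).
Proof.
by move=> sA sB x y; rewrite !bopDE !bopNE linearBl linearBr /= sA sB.
Qed.

Lemma quadD A B x : quad (A + B) x = quad A x + quad B x.
Proof. by rewrite /quad bopDE rinnerDl. Qed.

Lemma quadB A B x : quad (A - B) x = quad A x - quad B x.
Proof. by rewrite /quad bopDE bopNE rinnerBl. Qed.

Lemma quadZ a A x : quad (a%:C *: A) x = a * quad A x.
Proof. by rewrite /quad bopZE rinnerZl. Qed.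

Lemma quad_conj A B x : quad (B * A * adjoint B) x = quad A (adjoint B x).
Proof. by rewrite /quad !bopME /rinner adjointP. Qed.

Lemma symmetric_inner_quad A x : symmetric_op A -> inner (A x) x = (quad A x)%:C.
Proof.
move=> sA; rewrite /quad /rinner; have := innerC (A x) x.
rewrite -sA; case: (inner (A x) x) => u w [] wN /=.
by congr (_ +i* _); lra.
Qed.

Lemma op_ge0P A : symmetric_op A -> op_ge0 A <-> bounded_below 0 A.
Proof.
move=> sA; split=> A0 x; first by rewrite mul0r -lecR -symmetric_inner_quad.
by rewrite symmetric_inner_quad// lecR; have := A0 x; rewrite mul0r.
Qed.

Lemma bounded_belowW c d A : d <= c -> bounded_below c A -> bounded_below d A.
Proof. by move=> dc cA x; apply: le_trans (cA x); rewrite ler_wpM2r ?sqr_ge0. Qed.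

Lemma quad_abs A x : `|quad A x| <= rnorm A * rnorm x ^+ 2.
Proof.
apply: le_trans (rinner_abs _ _) _.
by rewrite expr2 mulrA ler_wpM2r ?rnorm_ge0// rnormM.
Qed.

Lemma bounded_below_near c e A B :
  bounded_below c A -> rnorm (B - A) <= e -> bounded_below (c - e) B.
Proof.
move=> cA BA x; have := cA x; have := quad_abs (B - A) x.
rewrite quadB ler_norml => /andP[h _].
have := ler_wpM2r (sqr_ge0 (rnorm x)) BA; lra.
Qed.

(** Positivity of <A v, v> at v = x - A x / M, where M >= |A|, gives
|A x|^2 <= M <A x, x>; the inverse B bounds |x| by |B| |A x|. *)
Lemma op_gt0_bounded_below A : symmetric_op A -> op_gt0 A ->
  exists2 c, 0 < c & bounded_below c A.
Proof.
move=> sA [/(op_ge0P sA) A0 [B [_ BA]]].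
(* Adding 1 keeps M and N positive on the zero space. *)
pose M := rnorm A + 1; pose N := rnorm B + 1.
have M0 : 0 < M by rewrite ltr_wpDl ?rnorm_ge0.
have N0 : 0 < N by rewrite ltr_wpDl ?rnorm_ge0.
have AxM x : rnorm (A x) ^+ 2 <= M * quad A x.
  have := A0 (x - M^-1%:C *: A x).
  have -> : quad A (x - M^-1%:C *: A x) =
      quad A x - 2 * M^-1 * rnorm (A x) ^+ 2 + M^-1 ^+ 2 * quad A (A x).
    rewrite /quad bop_morphB bop_morphZ !(rinnerBl, rinnerBr, rinnerZl, rinnerZr).
    by rewrite (rsymmetric sA (A x) x) rinnerxx; ring.
  have h : M^-1 * quad A (A x) <= rnorm (A x) ^+ 2.
    rewrite mulrC ler_pdivrMr// mulrC.
    have := quad_abs A (A x); rewrite ler_norml => /andP[_ h].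
    by apply: le_trans h _; rewrite ler_wpM2r ?sqr_ge0// lerDl.
  have {}h : M^-1 ^+ 2 * quad A (A x) <= M^-1 * rnorm (A x) ^+ 2.
    by rewrite expr2 -mulrA ler_wpM2l// invr_ge0 ltW.
  move=> h1; rewrite -ler_pdivrMl//; lra.
have xN x : rnorm x ^+ 2 <= N ^+ 2 * rnorm (A x) ^+ 2.
  rewrite -exprMn ler_pXn2r// ?nnegrE ?mulr_ge0 ?rnorm_ge0 ?(ltW N0)//.
  have {1}-> : x = B (A x) by rewrite -bopME BA.
  apply: le_trans (rnormM _ _) _.
  by rewrite ler_wpM2r ?rnorm_ge0// lerDl.
exists (N ^+ 2 * M)^-1; first by rewrite invr_gt0 mulr_gt0 ?exprn_gt0.
move=> x; rewrite mulrC ler_pdivrMr ?mulr_gt0 ?exprn_gt0//.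
apply: le_trans (xN x) _; rewrite [leRHS]mulrCA ler_pM2l ?exprn_gt0// mulrC.
exact: AxM.
Qed.

(** A is onto by [coercive_weak_solution]; c |x| <= |A x| makes it injective
and bounds the inverse by 1 / c. *)
Lemma bounded_below_op_gt0 c A : symmetric_op A -> 0 < c -> bounded_below c A ->
  op_gt0 A.
Proof.
move=> sA c0 cA; split.
  by apply/(op_ge0P sA); apply: bounded_belowW cA; exact: ltW.
have /choice[f fP] : forall y, exists x, y = A x.
  move=> y; have [x xP] := coercive_weak_solution 1 y sA c0 cA.
  by exists x; apply: inner_inj => v; rewrite -xP.
have Alb x : c * rnorm x <= rnorm (A x).
  have [->|x0] := eqVneq x 0.
    by rewrite rnorm0 mulr0 rnorm_ge0.
  have nx0 : 0 < rnorm x by rewrite rnorm_gt0.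
  rewrite -(ler_pM2r nx0) -mulrA -expr2.
  by apply: le_trans (cA x) _; exact: rinner_cauchy_schwarz.
have Ainj x y : A x = A y -> x = y.
  move=> Axy; apply/eqP; rewrite -subr_eq0 -rnorm_eq0 eq_le rnorm_ge0 andbT.
  rewrite -(pmulr_rle0 _ c0); apply: le_trans (Alb _) _.
  by rewrite bop_morphB Axy subrr rnorm0.
have lf : linear f.
  by move=> a y z; apply: Ainj; rewrite -fP bop_morphD bop_morphZ -!fP.
have bf y : rnorm (f y) <= c^-1 * rnorm y.
  by rewrite mulrC ler_pdivlMr// mulrC {2}(fP y).
exists (Bop (bounded_operatorI lf bf)); split; apply: bopP => x.
  by rewrite bopME /= -fP.
by rewrite bopME; apply: Ainj; rewrite /= -fP.
Qed.

End Positivity.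

(** * Products of the maps id - P_i *)

Section PositiveMaps.
Context {R : realType} {H : hilbertType R}.
Implicit Types (x : H) (A B Z : bop H) (c s t : R) (F G : bop H -> bop H).

Definition positive_map F :=
  [/\ forall A B, F (A - B) = F A - F B,
      forall c A, F (c%:C *: A) = c%:C *: F A
    & forall A, bounded_below 0 A -> bounded_below 0 (F A)].

Definition dominated s F G := forall A,
  bounded_below 0 A -> forall x, quad (G A) x <= s * quad (F A) x.

Lemma positive_map_lower_bound F t Z :
  positive_map F -> bounded_below 0 (1 - F 1) -> 0 <= t ->
  bounded_below (- t) Z -> bounded_below (- t) (F Z).
Proof.
move=> [FB FZ F0] F1 t0 tZ x.
have /F0/(_ x) : bounded_below 0 (Z - (- t)%:C *: (1 : bop H)).
  by move=> y; rewrite mul0r quadB quadZ quad1 subr_ge0.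
have := F1 x; rewrite FB FZ !quadB quadZ quad1 !mul0r => h1 h2.
have := mulr_ge0 t0 h1; lra.
Qed.

(** Each lower bound - t <= 0 of Z improves to c - t, by
Z = (Z - F Z) + F Z; after finitely many improvements, starting from
t = |Z|, the lower bound 0 is reached, and one more gives c. *)
Lemma coercive_defect_bounded_below F c Z :
  positive_map F -> bounded_below 0 (1 - F 1) -> 0 < c ->
  bounded_below c (Z - F Z) -> bounded_below c Z.
Proof.
move=> pF F1 c0 cZ.
have step t : 0 <= t -> bounded_below (- t) Z -> bounded_below (c - t) Z.
  move=> t0 /(positive_map_lower_bound pF F1 t0) tFZ x.
  by have := cZ x; have := tFZ x; rewrite quadB; lra.
have Zn n : bounded_below (- Num.max 0 (rnorm Z - n%:R * c)) Z.
  elim: n => [|n IHn].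
    apply: (@bounded_belowW _ _ (- rnorm Z)).
      by rewrite mul0r subr0 lerN2 le_max lexx orbT.
    by move=> x; have := quad_abs Z x; rewrite ler_norml mulNr => /andP[].
  have m0 : 0 <= Num.max 0 (rnorm Z - n%:R * c) by rewrite le_max lexx.
  apply: bounded_belowW (step _ m0 IHn).
  rewrite -natr1 mulrDl mul1r.
  case: (leP 0 (rnorm Z - (n%:R * c + c))) => h1;
    case: (leP 0 (rnorm Z - n%:R * c)) => h2; lra.
have Z0 : bounded_below (- 0) Z.
  have := Zn (Num.bound (rnorm Z / c)).
  suff -> : Num.max 0 (rnorm Z - (Num.bound (rnorm Z / c))%:R * c) = 0 by [].
  apply/max_idPl; rewrite subr_le0 -ler_pdivrMr//.
  by apply/ltW/archi_boundP; rewrite divr_ge0 ?rnorm_ge0// ltW.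
by have := step _ (lexx 0) Z0; rewrite subr0.
Qed.

(** The left-hand side is <(Z - s F Z) x, x>. *)
Lemma dominated_defect F G s Z x : 0 <= s -> dominated s F G ->
  bounded_below 0 Z ->
  (1 - s) * quad Z x + s * quad (Z - F Z) x <= quad (Z - G Z) x.
Proof. by move=> s0 FG /FG/(_ x); rewrite !quadB; lra. Qed.

Section Defects.
Variable I : eqType.
Implicit Types (P Q : I -> bop H -> bop H) (u v : seq I).

(** The composition, in the order of u, of the maps id - P_i, applied to Z. *)
Definition defect P u Z := foldr (fun i Y => Y - P i Y) Z u.

Lemma defect_cat P u v Z : defect P (u ++ v) Z = defect P u (defect P v Z).
Proof. exact: foldr_cat. Qed.

Lemma defect_commute F P u Z :
  (forall A B, F (A - B) = F A - F B) ->
  (forall i, i \in u -> forall A, F (P i A) = P i (F A)) ->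
  F (defect P u Z) = defect P u (F Z).
Proof.
move=> FB; elim: u => //= i u IHu FP.
rewrite FB FP ?mem_head// IHu// => j ju; apply: FP.
by rewrite inE ju orbT.
Qed.

Lemma defectB P u Y Z : (forall i, positive_map (P i)) ->
  defect P u (Y - Z) = defect P u Y - defect P u Z.
Proof.
move=> pP; elim: u => //= i u ->; have [PB _ _] := pP i.
by rewrite PB !opprB addrACA [in RHS]addrACA; congr (_ + _); rewrite addrC.
Qed.

Lemma defect_perm P u v Z :
  (forall i, positive_map (P i)) ->
  (forall i j A, P i (P j A) = P j (P i A)) ->
  perm_eq u v -> defect P u Z = defect P v Z.
Proof.
move=> pP PC; elim: u v => [|i u IHu] v uv.
  by have := perm_size uv; case: v {uv}.
have iv : i \in v by rewrite -(perm_mem uv) mem_head.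
case/splitPr: iv uv => v1 v2 uv.
have uv' : perm_eq u (v1 ++ v2).
  by rewrite -(perm_cons i) (perm_trans uv)// -cat1s perm_catCA.
rewrite /= (IHu _ uv') !defect_cat /=.
have [PB _ _] := pP i.
rewrite (defectB _ _ _ pP) (defect_commute (F := P i))//.
Qed.

(** The factors of u are the outermost ones, so
[coercive_defect_bounded_below] removes them one by one. *)
Lemma defect_suffix_bounded_below P c u v :
  (forall i, positive_map (P i)) -> (forall i, bounded_below 0 (1 - P i 1)) ->
  0 < c -> bounded_below c (defect P (u ++ v) 1) ->
  bounded_below c (defect P v 1).
Proof.
move=> pP P1 c0; elim: u => //= i u IHu /(coercive_defect_bounded_below (pP i) (P1 i) c0).
exact: IHu.
Qed.

Section Domination.
Variables (P Q : I -> bop H -> bop H) (s : R).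
Hypotheses (s0 : 0 <= s) (s1 : s <= 1).
Hypothesis pP : forall i, positive_map (P i).
Hypothesis pQ : forall i, positive_map (Q i).
Hypothesis PQ : forall i, dominated s (P i) (Q i).
Hypothesis PQC : forall i j, i != j -> forall A, P i (Q j A) = Q j (P i A).

Lemma defect_exchange i u Z : i \notin u ->
  defect Q u Z - P i (defect Q u Z) = defect Q u (Z - P i Z).
Proof.
move=> iu; have [PB _ _] := pP i.
rewrite (defectB _ _ _ pQ) -(defect_commute (F := P i))// => j ju.
by apply: PQC; apply: contraNneq iu => ->.
Qed.

(** Induction on the list u of replaced factors.  Splitting off the factor
of i and writing Z for the remaining defect, both Z and Z - P_i Z are mixed
defects with fewer replaced factors, and [dominated_defect] bounds
Z - Q_i Z below by a convex combination of them. *)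
Lemma mixed_defect_bounded_below c u v : 0 <= c ->
  (forall w, uniq w -> bounded_below c (defect P w 1)) ->
  uniq (u ++ v) -> bounded_below c (defect Q u (defect P v 1)).
Proof.
move=> c0 cP; elim: u v => [|i u IHu] v /=; first exact: cP.
move=> /andP[iuv uv]; set Z := defect Q u _.
have cZ : bounded_below c Z by exact: IHu.
have cPZ : bounded_below c (Z - P i Z).
  rewrite defect_exchange; last by move: iuv; rewrite mem_cat negb_or => /andP[].
  by apply: (IHu (i :: v)); rewrite -cat1s uniq_catCA /= iuv.
have Z0 : bounded_below 0 Z by apply: bounded_belowW cZ.
move=> x; apply: le_trans (dominated_defect x s0 (PQ i) Z0).
have := ler_wpM2l s0 (cPZ x); have h : 0 <= 1 - s by rewrite subr_ge0.
have := ler_wpM2l h (cZ x); lra.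
Qed.

(** When the defects of P are only nonnegative, the term (1 - s) Z in
[dominated_defect] still gains a factor 1 - s for each replaced map. *)
Lemma strict_defect_bounded_below u :
  (forall w, uniq w -> bounded_below 0 (defect P w 1)) ->
  uniq u -> bounded_below ((1 - s) ^+ size u) (defect Q u 1).
Proof.
move=> P0; have s1' : 0 <= 1 - s by rewrite subr_ge0.
elim: u => [_ x|i u IHu iu]; first by rewrite /= quad1 expr0 mul1r.
move: (iu) => /= /andP[iNu uu]; set Z := defect Q u 1.
have Z0 : bounded_below 0 Z.
  by apply: (mixed_defect_bounded_below (v := [::])); rewrite ?cats0.
have PZ0 : bounded_below 0 (Z - P i Z).
  rewrite defect_exchange//.
  by apply: (mixed_defect_bounded_below (v := [:: i])); rewrite // cats1 rcons_uniq iNu.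
move=> x; apply: le_trans (dominated_defect x s0 (PQ i) Z0).
have := PZ0 x; rewrite mul0r => /(mulr_ge0 s0) h.
have := ler_wpM2l s1' (IHu uu x); rewrite mulrA -exprS -/Z /= => h'.
lra.
Qed.

End Domination.
End Defects.
End PositiveMaps.

(** * The completely positive maps of a block *)

Section PhiMaps.
Context {R : realType} {H : hilbertType R}.
Implicit Types (x : H) (A B Y Z : bop H) (c r : R).

Lemma bop_scalerAl (a : R[i]) A B : a *: (A * B) = (a *: A) * B.
Proof. exact: bopP. Qed.

Lemma bop_scalerAr (a : R[i]) A B : a *: (A * B) = A * (a *: B).
Proof. by apply: bopP => x; rewrite bopME !bopZE bop_morphZ. Qed.

Lemma word_op_commute (m n : nat) (X : 'I_m -> bop H) (X' : 'I_n -> bop H) v w :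
  (forall j l, X j * X' l = X' l * X j) ->
  word_op X v * word_op X' w = word_op X' w * word_op X v.
Proof.
move=> XX'; apply: commr_prod => l _; apply/commr_sym/commr_prod => j _.
exact/esym.
Qed.

Lemma word_opZ (n : nat) (z : 'I_n -> R[i]) (X : 'I_n -> bop H) w :
  word_op (fun j => z j *: X j) w = (\prod_(j <- w) z j) *: word_op X w.
Proof.
rewrite /word_op; elim: w => [|j w IHw]; first by rewrite !big_nil scale1r.
by rewrite !big_cons IHw -bop_scalerAl -bop_scalerAr scalerA.
Qed.

Variables (n : nat) (a : ncpoly R n).
Implicit Types X : 'I_n -> bop H.

Lemma quad_sum (I : Type) (s : seq I) (F : I -> bop H) x :
  quad (\sum_(i <- s) F i) x = \sum_(i <- s) quad (F i) x.
Proof.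
elim: s => [|i s IHs]; last by rewrite !big_cons quadD IHs.
by rewrite !big_nil /quad bop0E /rinner linear0l.
Qed.

Lemma quad_Phi X Y x : quad (Phi a X Y) x =
  \sum_(w <- finsupp a) a w * quad Y (adjoint (word_op X w) x).
Proof.
by rewrite /Phi quad_sum; apply: eq_bigr => w _; rewrite quadZ quad_conj.
Qed.

Lemma symmetric_Phi X Y : symmetric_op Y -> symmetric_op (Phi a X Y).
Proof.
move=> sY; rewrite /Phi; elim/big_rec: _ => [|w A _ sA]; first exact: symmetric0.
by apply: symmetricD => //; apply/symmetricZ/symmetric_conj.
Qed.

Lemma PhiB X Y Z : Phi a X (Y - Z) = Phi a X Y - Phi a X Z.
Proof.
rewrite /Phi -sumrB; apply: eq_bigr => w _.
by rewrite mulrBr mulrBl scalerBr.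
Qed.

Lemma PhiZ X (c : R[i]) Y : Phi a X (c *: Y) = c *: Phi a X Y.
Proof.
rewrite /Phi scaler_sumr; apply: eq_bigr => w _.
by rewrite -bop_scalerAr -bop_scalerAl !scalerA mulrC.
Qed.

Lemma PhiD X Y Z : Phi a X (Y + Z) = Phi a X Y + Phi a X Z.
Proof.
rewrite /Phi -big_split; apply: eq_bigr => w _ /=.
by rewrite mulrDr mulrDl scalerDr.
Qed.

Lemma Phi_sum X (I : Type) (s : seq I) (F : I -> bop H) :
  Phi a X (\sum_(i <- s) F i) = \sum_(i <- s) Phi a X (F i).
Proof.
elim: s => [|i s IHs]; last by rewrite !big_cons PhiD IHs.
by rewrite !big_nil -[in LHS](subrr 0) PhiB subrr.
Qed.

Hypothesis areg : positive_regular a.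

Lemma Phi_positive X : positive_map (Phi a X).
Proof.
have [a0 _ _] := areg; split; [exact: PhiB|by move=> c A; exact: PhiZ|].
move=> A A0 x; rewrite mul0r quad_Phi sumr_ge0// => w _.
by rewrite mulr_ge0//; have := A0 (adjoint (word_op X w) x); rewrite mul0r.
Qed.

Lemma prod_norm_le (z : 'I_n -> R[i]) r w : r <= 1 ->
  (forall j, `|z j| <= r%:C) -> w != [::] ->
  `|\prod_(j <- w) z j| ^+ 2 <= r%:C.
Proof.
move=> r1 zr; have z1 u : `|\prod_(j <- u) z j| <= 1.
  rewrite normr_prod; apply: prodr_ile1 => i _; rewrite normr_ge0 /=.
  by apply: le_trans (zr i) _; rewrite lecR.
case: w => // j w _; rewrite expr2 -[leRHS]mulr1 ler_pM//.
by rewrite big_cons normrM -[leRHS]mulr1 ler_pM.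
Qed.

(** The word w contributes the factor |z_w|^2 <= r if w is nonempty; the
empty word has coefficient 0. *)
Lemma Phi_dominated (z : 'I_n -> R[i]) X r : r <= 1 ->
  (forall j, `|z j| <= r%:C) ->
  dominated r (Phi a X) (Phi a (fun j => z j *: X j)).
Proof.
move=> r1 zr Y Y0 x; have [a0 a1 _] := areg.
rewrite !quad_Phi mulr_sumr; apply: ler_sum => w _.
have [->|w0] := eqVneq w [::]; first by rewrite a1 !mul0r mulr0.
rewrite mulrCA ler_wpM2l// word_opZ adjointZ bopZE.
set v := adjoint _ x; set zw := \prod_(j <- w) z j.
have zwE : `|zw| ^+ 2 = (rnorm (zw : R[i]^o) ^+ 2)%:C by rewrite rmorphXn /= rnormE.
have -> : quad Y (Num.conj zw *: v) = rnorm (zw : R[i]^o) ^+ 2 * quad Y v.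
  rewrite /quad /rinner bop_morphZ linearZl_LR linearZr_LR /= conjCK mulrA.
  rewrite mulrC -normCKC.
  by rewrite zwE; case: (inner _ _) => u t /=; rewrite mulr0 subr0 mulrC.
apply: ler_wpM2r; first by have := Y0 v; rewrite mul0r.
by rewrite -lecR -zwE prod_norm_le.
Qed.

End PhiMaps.

Lemma Phi_commute (R : realType) (H : hilbertType R) (m n : nat)
    (a : ncpoly R m) (b : ncpoly R n) (X : 'I_m -> bop H) (X' : 'I_n -> bop H) Y :
  (forall j l, X j * X' l = X' l * X j) ->
  Phi a X (Phi b X' Y) = Phi b X' (Phi a X Y).
Proof.
move=> XX'; rewrite {2}/Phi Phi_sum [in RHS]/Phi.
rewrite [LHS](eq_bigr (fun w => \sum_(v <- finsupp a)
  (b w)%:C *: ((a v)%:C *: (word_op X v * (word_op X' w * Y *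
   adjoint (word_op X' w)) * adjoint (word_op X v))))); last first.
  by move=> w _; rewrite PhiZ /Phi scaler_sumr.
apply: eq_bigr => w _.
rewrite -scaler_sumr; congr (_ *: _); rewrite mulr_sumr mulr_suml.
apply: eq_bigr => v _; rewrite -bop_scalerAr -bop_scalerAl; congr (_ *: _).
rewrite !mulrA (word_op_commute v w XX') -!mulrA; do 3 congr (_ * _).
by rewrite -!adjointM (word_op_commute v w XX').
Qed.

(** * Defects of a commuting tuple *)

Section Blocks.
Context {R : realType} {H : hilbertType R} {k : nat} {n : 'I_k -> nat}.
Variable q : forall i, ncpoly R (n i).
Hypothesis qreg : forall i, positive_regular (q i).
Implicit Types (X : @op_tuple R H k n) (c r : R) (u v : seq 'I_k).

Definition block_map X i : bop H -> bop H := Phi (q i) (X i).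

Definition defects_bounded_below c X :=
  forall u, uniq u -> bounded_below c (defect (block_map X) u 1).

Lemma DeltaE p X Y :
  Delta q p X Y = defect (block_map X) [seq i <- index_enum 'I_k | p i] Y.
Proof.
rewrite /Delta; elim: (index_enum _) => [|i s IHs]; first by rewrite big_nil.
by rewrite big_cons /= IHs; case: (p i).
Qed.

Lemma block_map_positive X i : positive_map (block_map X i).
Proof. exact: Phi_positive. Qed.

Lemma block_map_commute X : commuting_tuples X ->
  forall i j A, block_map X i (block_map X j A) = block_map X j (block_map X i A).
Proof.
move=> cX i j A; have [->//|ij] := eqVneq i j.
by apply: Phi_commute => l m; exact: cX.
Qed.

Lemma symmetric_defect X u : symmetric_op (defect (block_map X) u 1).
Proof.
elim: u => [|i u IHu] /=; first exact: symmetric1.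
by apply: symmetricB => //; exact: symmetric_Phi.
Qed.

Lemma defect_Delta X u : commuting_tuples X -> uniq u ->
  defect (block_map X) u 1 = Delta q (mem u) X 1.
Proof.
move=> cX uu; rewrite DeltaE; apply: defect_perm.
- exact: block_map_positive.
- exact: block_map_commute.
apply: uniq_perm => //; first by rewrite filter_uniq// index_enum_uniq.
by move=> i; rewrite mem_filter mem_index_enum andbT.
Qed.

Lemma polydomain_minusP X :
  polydomain_minus q X <-> commuting_tuples X /\ defects_bounded_below 0 X.
Proof.
split=> -[cX X0]; split=> //.
  move=> u uu; apply/(op_ge0P (symmetric_defect X u)).
  by rewrite defect_Delta.
move=> p; rewrite DeltaE; apply/(op_ge0P (symmetric_defect _ _))/X0.
by rewrite filter_uniq// index_enum_uniq.
Qed.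

(** Any duplicate-free list u is a suffix of a rearrangement of the list of all
blocks, so that [defect_suffix_bounded_below] carries the lower bound of the
full defect over to u. *)
Lemma polydomainP X :
  polydomain q X <->
  commuting_tuples X /\ exists2 c, 0 < c & defects_bounded_below c X.
Proof.
split=> [[[cX]]|[cX [c c0 cD]]].
  rewrite DeltaE => /(op_gt0_bounded_below (symmetric_defect _ _)) [c c0 cD] X1.
  split=> //; exists c => // u uu.
  apply: (@defect_suffix_bounded_below _ _ _ _ _
    [seq i <- index_enum 'I_k | [predC u] i]) => //.
  - exact: block_map_positive.
  - move=> i; have := X1 i; rewrite (op_ge0P (symmetric_defect X [:: i])).
    exact.
  move: cD; rewrite (@defect_perm _ _ _ _ _
    ([seq i <- index_enum 'I_k | [predC u] i] ++ u))//.
  - exact: block_map_positive.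
  - exact: block_map_commute.
  apply: uniq_perm; first by rewrite filter_uniq// index_enum_uniq.
    rewrite cat_uniq uu filter_uniq ?index_enum_uniq// andbT /=.
    by apply/hasPn => i iu; rewrite mem_filter /= iu.
  move=> i; rewrite mem_cat !mem_filter mem_index_enum !andbT /=.
  by rewrite orNb.
split.
  split=> //; rewrite DeltaE.
  apply: (bounded_below_op_gt0 (symmetric_defect _ _) c0).
  by apply: cD; rewrite filter_uniq// index_enum_uniq.
move=> i; apply/(op_ge0P (symmetric_defect X [:: i])).
by apply: bounded_belowW (cD [:: i] _); rewrite // ltW.
Qed.

Lemma polydomain_sub_minus : @polydomain R H k n q `<=` polydomain_minus q.
Proof.
move=> X /polydomainP[cX [c c0 cD]]; apply/polydomain_minusP; split=> // u uu.
by apply: bounded_belowW (cD u uu); exact: ltW.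
Qed.

Lemma commuting_cscale z X : commuting_tuples X -> commuting_tuples (cscale z X).
Proof.
move=> cX s t st j l; rewrite /cscale -!bop_scalerAl -!bop_scalerAr cX//.
by rewrite !scalerA mulrC.
Qed.

Lemma block_map_cscale_commute z X i j A : commuting_tuples X -> i != j ->
  block_map X i (block_map (cscale z X) j A) =
  block_map (cscale z X) j (block_map X i A).
Proof.
move=> cX ij; apply: Phi_commute => l m.
by rewrite /cscale -bop_scalerAl -bop_scalerAr cX.
Qed.

Lemma defects_bounded_below_cscale c z X : commuting_tuples X -> 0 <= c ->
  closed_polydisc z -> defects_bounded_below c X ->
  defects_bounded_below c (cscale z X).
Proof.
move=> cX c0 z1 cD u uu.
apply: (@mixed_defect_bounded_below _ _ _ (block_map X) _ 1 _ _ _ _ _ _ _ _ [::]) => //.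
- exact: block_map_positive.
- exact: block_map_positive.
- by move=> i; apply: Phi_dominated => // j; exact: z1.
- by move=> i j ij A; exact: block_map_cscale_commute.
by rewrite cats0.
Qed.

Lemma complete_reinhardt_polydomain : complete_reinhardt (@polydomain R H k n q).
Proof.
move=> X z /polydomainP[cX [c c0 cD]] z1; apply/polydomainP.
split; first exact: commuting_cscale.
by exists c => //; apply: defects_bounded_below_cscale => //; exact: ltW.
Qed.

Lemma complete_reinhardt_polydomain_minus :
  complete_reinhardt (@polydomain_minus R H k n q).
Proof.
move=> X z /polydomain_minusP[cX cD] z1; apply/polydomain_minusP.
split; first exact: commuting_cscale.
exact: defects_bounded_below_cscale.
Qed.

Lemma cscale_polydomain_minus z X : open_polydisc z ->
  polydomain_minus q X -> polydomain q (cscale z X).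
Proof.
move=> z1 /polydomain_minusP[cX cD].
pose r : R := \big[Num.max/0]_(p : {i & 'I_(n i)})
  rnorm (z (tag p) (tagged p) : R[i]^o).
have r0 : 0 <= r by rewrite /r bigmax_ge_id.
have zr i j : `|z i j| <= r%:C.
  rewrite -(rnormE (z i j : R[i]^o)) lecR.
  exact: (le_bigmax _ (fun p : {i & 'I_(n i)} =>
    rnorm (z (tag p) (tagged p) : R[i]^o)) (Tagged _ j)).
have r1 : r < 1.
  apply: bigmax_lt => // p _; rewrite -ltcR rnormE; exact: z1.
apply/polydomainP; split; first exact: commuting_cscale.
have r1' : 0 < 1 - r by rewrite subr_gt0.
exists ((1 - r) ^+ k); first by rewrite exprn_gt0.
move=> u uu; apply: (@bounded_belowW _ _ ((1 - r) ^+ size u)).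
  rewrite ler_wiXn2l ?(ltW r1')// ?gerDl ?oppr_le0//.
  by rewrite -[leqRHS]card_ord -(card_uniqP uu) max_card.
apply: (@strict_defect_bounded_below _ _ _ (block_map X) _ r) => //.
- exact: ltW.
- exact: block_map_positive.
- exact: block_map_positive.
- by move=> i; apply: Phi_dominated => //; exact: ltW.
by move=> i j ij A; exact: block_map_cscale_commute.
Qed.

Lemma rscale_polydomain_minus r X : 0 <= r -> r < 1 ->
  polydomain_minus q X -> polydomain q (rscale r X).
Proof.
move=> r0 r1 mX; apply: (@cscale_polydomain_minus (fun _ _ => r%:C)) => // i j.
by rewrite rnorm_complex// ltcR.
Qed.

End Blocks.

(** * Norm continuity *)

Section OperatorLimits.
Context {R : realType}.

Lemma cvg_rnormP (V : normedModType R[i]) (T : Type) (F : set_system T)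
    (FF : Filter F) (f : T -> V) (a : V) :
  f @ F --> a <-> forall e : R, 0 < e -> \forall t \near F, rnorm (f t - a) <= e.
Proof.
split=> [/cvgrPdistC_lt fa e e0|fa].
  have e0' : 0 < e%:C by rewrite ltcR.
  by apply: filterS (fa _ e0') => t /ltW; rewrite -rnormE lecR.
apply/cvgrPdistC_lt => _ /gt0_complexP[d d0 ->].
have d20 : 0 < d / 2 by rewrite divr_gt0.
by apply: filterS (fa _ d20) => t ft; rewrite -rnormE ltcR; lra.
Qed.

Context {H : hilbertType R}.
Implicit Types A B : bop H.

Lemma rnorm_opM A B : rnorm (A * B) <= rnorm A * rnorm B.
Proof.
rewrite {1}/rnorm bop_normE /=; apply: opnorm_le => [|x].
  by rewrite mulr_ge0 ?rnorm_ge0.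
rewrite -!rnormE -rmorphM lecR bopME -mulrA.
by apply: le_trans (rnormM _ _) _; rewrite ler_wpM2l ?rnorm_ge0// rnormM.
Qed.

Variables (T : Type) (F : set_system T).
Context {FF : Filter F}.
Implicit Types f g : T -> bop H.

Lemma cvg_opM f g A B :
  f @ F --> A -> g @ F --> B -> (fun t => f t * g t) @ F --> A * B.
Proof.
move=> /cvg_rnormP fA /cvg_rnormP gB; apply/cvg_rnormP => e e0.
pose M := rnorm A + rnorm B + 1; pose d := Num.min 1 (e / M).
have A0 := rnorm_ge0 A; have B0 := rnorm_ge0 B.
have M0 : 0 < M by rewrite /M; lra.
have d0 : 0 < d by rewrite lt_min ltr01 divr_gt0.
apply: filterS2 (fA _ d0) (gB _ d0) => t fd gd.
have -> : f t * g t - A * B =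
    (f t - A) * (g t - B) + ((f t - A) * B + A * (g t - B)).
  by rewrite addrA -mulrDr subrK mulrBl mulrBr addrA subrK.
have [d1 de] : d <= 1 /\ d * M <= e.
  by rewrite -ler_pdivlMr// !ge_min !lexx orbT.
have ft0 := rnorm_ge0 (f t - A); have gt0 := rnorm_ge0 (g t - B).
apply: le_trans (rnormD _ _) _; apply: le_trans (lerD (lexx _) (rnormD _ _)) _.
apply: le_trans (lerD (rnorm_opM _ _) (lerD (rnorm_opM _ _) (rnorm_opM _ _))) _.
have h1 := ler_pM ft0 gt0 fd gd.
have h2 := ler_wpM2r B0 fd; have h3 := ler_wpM2l A0 gd.
have h4 := ler_wpM2l (ltW d0) d1.
by rewrite /M in de; nra.
Qed.

Lemma cvg_adjoint f A : f @ F --> A -> (fun t => adjoint (f t)) @ F --> adjoint A.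
Proof.
move=> /cvg_rnormP fA; apply/cvg_rnormP => e /fA; apply: filterS => t.
by rewrite -adjointB; exact: le_trans (rnorm_adjoint _).
Qed.

Lemma cvg_op_sum (I : Type) (s : seq I) (f : I -> T -> bop H) (A : I -> bop H) :
  (forall i, f i @ F --> A i) ->
  (fun t => \sum_(i <- s) f i t) @ F --> \sum_(i <- s) A i.
Proof.
move=> fA; elim: s => [|i s IHs].
  by under eq_fun do rewrite big_nil; rewrite big_nil; exact: cvg_cst.
under eq_fun do rewrite big_cons; rewrite big_cons.
exact: cvgD.
Qed.

Lemma cvg_word_op (n : nat) (X : T -> 'I_n -> bop H) (X0 : 'I_n -> bop H) w :
  (forall j, X ^~ j @ F --> X0 j) ->
  (fun t => word_op (X t) w) @ F --> word_op X0 w.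
Proof.
move=> XX0; rewrite /word_op; elim: w => [|j w IHw].
  by under eq_fun do rewrite big_nil; rewrite big_nil; exact: cvg_cst.
under eq_fun do rewrite big_cons; rewrite big_cons.
exact: cvg_opM.
Qed.

Lemma cvg_Phi (n : nat) (a : ncpoly R n) (X : T -> 'I_n -> bop H)
    (X0 : 'I_n -> bop H) f A :
  (forall j, X ^~ j @ F --> X0 j) -> f @ F --> A ->
  (fun t => Phi a (X t) (f t)) @ F --> Phi a X0 A.
Proof.
move=> XX0 fA; apply: cvg_op_sum => w; apply: cvgZl_tmp.
by apply: cvg_opM; [apply: cvg_opM|apply: cvg_adjoint] => //; exact: cvg_word_op.
Qed.

End OperatorLimits.

(** * Topology of the domains *)

Section TupleTopology.
Context {R : realType} {H : hilbertType R} {k : nat} {n : 'I_k -> nat}.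
Implicit Types (X Y : @op_tuple R H k n) (c r : R) (u v : seq 'I_k).

Lemma op_tuple_eq X Y : (forall i j, X i j = Y i j) -> X = Y.
Proof.
move=> XY; apply: functional_extensionality_dep => i.
by apply: functional_extensionality_dep => j; exact: XY.
Qed.

Lemma cvg_prod_topology (I : Type) (K : I -> topologicalType) (T : Type)
    (F : set_system T) {FF : Filter F} (f : T -> prod_topology K)
    (x : prod_topology K) :
  (forall i, (fun t => f t i) @ F --> x i) -> f @ F --> x.
Proof.
move=> fx; apply/cvg_sup => i U [/= V [[W oW <-] Wx] WU].
have /fx FW : nbhs (x i) W by exact: open_nbhs_nbhs.
apply: (@filterS _ F FF (fun t => W (f t i))) FW => t Wt.
exact: WU.
Qed.

Lemma cvg_coordinate X i (j : 'I_(n i)) :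
  (fun Y : @op_tuple R H k n => Y i j) @ nbhs X --> X i j.
Proof.
have h1 := @proj_continuous _ (fun i : 'I_k => {ptws 'I_(n i) -> bop H}) i X.
have h2 := @proj_continuous _ (fun j : 'I_(n i) => bop H) j (X i).
exact: cvg_comp h1 h2.
Qed.

Lemma rscale_near X (U : set (@op_tuple R H k n)) : nbhs X U ->
  exists2 e : R, 0 < e & forall t, `|t - 1| <= e -> U (rscale t X).
Proof.
pose f (c : R[i]^o) : @op_tuple R H k n := fun i j => c *: X i j.
have f1 : f 1 = X by apply: op_tuple_eq => i j; rewrite /f scale1r.
have fc : f @ nbhs (1 : R[i]^o) --> f 1.
  apply: cvg_prod_topology => i; apply: cvg_prod_topology => j.
  by apply: cvgZr_tmp; exact: cvg_id.
rewrite -{1}f1 => /fc /nbhs_normP[_ /= /gt0_complexP[d d0 ->] dU].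
exists (d / 2); first by rewrite divr_gt0.
move=> t td; apply: dU => /=; rewrite distrC.
have -> : t%:C - 1 = (t - 1)%:C by rewrite rmorphB rmorph1.
rewrite normc_def /= expr0n addr0 sqrtr_sqr ltcR.
by apply: le_lt_trans td _; lra.
Qed.

Variable q : forall i, ncpoly R (n i).

Lemma cvg_defect X u :
  (fun Y => defect (block_map q Y) u 1) @ nbhs X --> defect (block_map q X) u 1.
Proof.
elim: u => [|i u IHu] /=; first exact: cvg_cst.
by apply: cvgB => //; apply: cvg_Phi => // j; exact: cvg_coordinate.
Qed.

Lemma near_defect_bounded_below c e X u : 0 < e ->
  bounded_below c (defect (block_map q X) u 1) ->
  \forall Y \near X, bounded_below (c - e) (defect (block_map q Y) u 1).
Proof.
move=> e0 cX; have /cvg_rnormP/(_ e e0) := @cvg_defect X u.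
by apply: filterS => Y; exact: bounded_below_near.
Qed.

Hypothesis qreg : forall i, positive_regular (q i).

(** The defects of the whole tuple and of each single block, all >= c I at X,
remain >= (c / 2) I nearby. *)
Lemma near_polydomain X : polydomain q X ->
  \forall Y \near X, commuting_tuples Y -> polydomain q Y.
Proof.
move=> /(polydomainP qreg)[cX [c c0 cD]].
have c20 : 0 < c / 2 by rewrite divr_gt0.
have cc : 0 < c - c / 2 by lra.
have near u : uniq u ->
    \forall Y \near X, bounded_below (c - c / 2) (defect (block_map q Y) u 1).
  by move=> uu; apply: near_defect_bounded_below => //; exact: cD.
have near1 : \forall Y \near X, forall i,
    bounded_below (c - c / 2) (defect (block_map q Y) [:: i] 1).
  exact: (@filter_forall _ _ _ _ (nbhs_filter X) (fun i => near [:: i] isT)).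
apply: filterS2 near1 (near _ (index_enum_uniq 'I_k)) => Y Y1 YD cY.
split.
  split=> //; rewrite DeltaE filter_predT.
  exact: bounded_below_op_gt0 (symmetric_defect q _ _) cc YD.
move=> i; apply/(op_ge0P (symmetric_defect q Y [:: i])).
by apply: bounded_belowW (Y1 i); exact: ltW.
Qed.

Lemma relatively_open_polydomain : relatively_open (@polydomain R H k n q).
Proof.
(* Away from the commuting tuples the open set is unconstrained. *)
exists (interior [set Y | commuting_tuples Y -> polydomain q Y]).
  exact: open_interior.
apply/seteqP; split=> [X XD|X [cX /interior_subset]]; last exact.
split; last exact: near_polydomain.
by case: XD => -[].
Qed.

(** Commutation relations and lower bounds pass to norm limits; conversely
r X with r < 1 close to 1 approximates X within the open domain. *)
Lemma closure_polydomain :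
  closure (@polydomain R H k n q) = polydomain_minus q.
Proof.
apply/seteqP; split=> X.
  move=> clX; apply/(polydomain_minusP qreg); split.
    move=> s t st j l; apply/eqP; rewrite -subr_eq0 -rnorm_eq0 eq_le rnorm_ge0.
    rewrite andbT; apply/ler_addgt0Pr => e e0; rewrite add0r.
    have : (fun Y : @op_tuple R H k n => Y s j * Y t l - Y t l * Y s j) @ nbhs X
        --> X s j * X t l - X t l * X s j.
      by apply: cvgB; apply: cvg_opM; exact: cvg_coordinate.
    move=> /cvg_rnormP/(_ e e0)/clX[Y [[[cY _] _] /=]].
    by rewrite cY// subrr sub0r rnormN.
  move=> u uu x; apply/ler_addgt0Pr => e e0.
  pose d := e / (rnorm x ^+ 2 + 1).
  have d0 : 0 < d by rewrite divr_gt0// ltr_wpDl// sqr_ge0.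
  have /cvg_rnormP/(_ d d0)/clX[Y [YD /= Yd]] := @cvg_defect X u.
  have /(polydomain_sub_minus qreg)/(polydomain_minusP qreg)[_ YD0] := YD.
  have Yd' : rnorm (defect (block_map q X) u 1 - defect (block_map q Y) u 1) <= d.
    by rewrite rnormB.
  have := bounded_below_near (YD0 u uu) Yd' x; rewrite mul0r sub0r => h.
  have : d * rnorm x ^+ 2 <= e.
    by rewrite /d mulrAC ler_pdivrMr ?ltr_wpDl ?sqr_ge0// ler_wpM2l ?ltW// ltrDl.
  lra.
move=> mX U /rscale_near[e e0 eU].
pose d := Num.min e 1; pose t := 1 - d / 2.
have d0 : 0 < d by rewrite lt_min e0 ltr01.
have [de d1] : d <= e /\ d <= 1 by rewrite !ge_min !lexx orbT.
exists (rscale t X); split; last first.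
  apply: eU; rewrite /t addrAC subrr add0r normrN ger0_norm; lra.
by apply: rscale_polydomain_minus => //; rewrite /t; lra.
Qed.

Lemma rscale_inv r X : r != 0 -> rscale r^-1 (rscale r X) = X.
Proof.
move=> r0; apply: op_tuple_eq => i j.
by rewrite /rscale scalerA -rmorphM mulVf// scale1r.
Qed.

(** X = r (r^-1 X) with r < 1 so close to 1 that r^-1 X is still in the domain. *)
Lemma polydomain_rscale X : polydomain q X ->
  exists r Y, [/\ 0 <= r, r < 1, polydomain q Y & rscale r Y = X].
Proof.
move=> XD; have /rscale_near[e e0 eD] := near_polydomain XD.
have cX : commuting_tuples X by case: XD => -[].
have t0 : 0 < 1 + e by lra.
exists (1 + e)^-1, (rscale (1 + e) X); split.
- by rewrite invr_ge0 ltW.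
- by rewrite invf_lt1 //; lra.
- apply: eD; first by rewrite addrAC subrr add0r ger0_norm// ltW.
  exact: commuting_cscale.
- by rewrite rscale_inv// gt_eqF.
Qed.

End TupleTopology.

Theorem proposition2p1 (R : realType) (k : nat) (n : 'I_k -> nat)
    (q : forall i, ncpoly R (n i)) (H : hilbertType R) :
  (0 < k)%N -> (forall i, (0 < n i)%N) ->
  (forall i, positive_regular (q i)) ->
  let D := @polydomain R H k n q in
  [/\ relatively_open D /\ closure D = polydomain_minus q,
      [/\ complete_reinhardt_domain D,
          [/\ D = \bigcup_(z in closed_polydisc) [set cscale z X | X in D],
              D = \bigcup_(z in open_polydisc) [set cscale z X | X in closure D]
            & D = \bigcup_(z in open_polydisc) [set cscale z X | X in D]],
          D = \bigcup_(r in [set r : R | 0 <= r < 1]) [set rscale r X | X in D]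
        & D = \bigcup_(r in [set r : R | 0 <= r < 1])
                [set rscale r X | X in closure D]]
    & [/\ complete_reinhardt (closure D),
          closure D =
            \bigcup_(z in closed_polydisc) [set cscale z X | X in closure D]
        & closure D =
            \bigcup_(r in [set r : R | 0 <= r <= 1])
              [set rscale r X | X in closure D]]].
Proof.
move=> _ _ qreg D; have clD : closure D = polydomain_minus q.
  exact: closure_polydomain.
have Dcl : D `<=` closure D by exact: subset_closure.
have DR : complete_reinhardt D by exact: complete_reinhardt_polydomain.
have clR : complete_reinhardt (closure D).
  by rewrite clD; exact: complete_reinhardt_polydomain_minus.
have openD z X : open_polydisc z -> closure D X -> D (cscale z X).
  by rewrite clD; exact: cscale_polydomain_minus.
have openr (r : R) : 0 <= r < 1 ->
    open_polydisc (fun i (_ : 'I_(n i)) => r%:C : R[i]).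
  by move=> /andP[r0 r1] i j; rewrite rnorm_complex// ltcR.
have closedr (r : R) : 0 <= r <= 1 ->
    closed_polydisc (fun i (_ : 'I_(n i)) => r%:C : R[i]).
  by move=> /andP[r0 r1] i j; rewrite rnorm_complex// lecR.
have Dr X : D X -> exists2 r : R, 0 <= r < 1 & exists2 Y, D Y & rscale r Y = X.
  move=> /(polydomain_rscale qreg)[r [Y [r0 r1 YD <-]]].
  by exists r; [rewrite r0|exists Y].
have rscale1 (X : @op_tuple R H k n) : rscale 1 X = X.
  by apply: op_tuple_eq => i j; rewrite /rscale scale1r.
have rangeP1 : 0 <= (1 : R) <= 1 by rewrite ler01 lexx.
split; [split=> //|split|split] => //.
- exact: relatively_open_polydomain.
- by split=> //; exact: relatively_open_polydomain.
- split; apply/seteqP; split.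
  + by move=> X XD; exists (fun _ _ => 1%:C); [exact: closedr|exists X; last exact: rscale1].
  + by move=> _ [z z1 [X XD <-]]; exact: DR.
  + move=> X /Dr[r r1 [Y /Dcl YD <-]].
    by exists (fun _ _ => r%:C); [exact: openr|exists Y].
  + by move=> _ [z z1 [X XD <-]]; exact: openD.
  + move=> X /Dr[r r1 [Y YD <-]].
    by exists (fun _ _ => r%:C); [exact: openr|exists Y].
  + by move=> _ [z z1 [X /Dcl XD <-]]; exact: openD.
- apply/seteqP; split.
  + by move=> X /Dr[r r1 [Y YD <-]]; exists r => //; exists Y.
  + by move=> _ [r /= /openr r1 [X /Dcl XD <-]]; exact: openD r1 XD.
- apply/seteqP; split.
  + by move=> X /Dr[r r1 [Y /Dcl YD <-]]; exists r => //; exists Y.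
  + by move=> _ [r /= /openr r1 [X XD <-]]; exact: openD r1 XD.
- apply/seteqP; split.
  + by move=> X XD; exists (fun _ _ => 1%:C); [exact: closedr|exists X; last exact: rscale1].
  + by move=> _ [z z1 [X XD <-]]; exact: clR.
- apply/seteqP; split.
  + by move=> X XD; exists 1; [|exists X; last exact: rscale1].
  + by move=> _ [r /= /closedr r1 [X XD <-]]; exact: clR XD r1.
Qed.
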